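(* Let $H\in\mathbb{N}$, $\alpha\in\mathbb{R}$, and let $\mathcal{L}_\infty$, $\mathcal{G}$, $V$, $\|\cdot\|$ be as in the context. Let $\gamma\in(0,\infty)$ and let $\Theta=(\Theta_n)_{n\in\mathbb{N}_0}\colon\mathbb{N}_0\to\mathbb{R}^{3H+1}$ satisfy for all $n\in\mathbb{N}_0$ that $\Theta_{n+1}=\Theta_n-\gamma\,\mathcal{G}(\Theta_n)$, and assume $\gamma\le(4V(\Theta_0)+2)^{-1}$. Then (i) $\sup_{n\in\mathbb{N}_0}\|\Theta_n\|\le[V(\Theta_0)]^{1/2}<\infty$; and (ii) $\limsup_{n\to\infty}\mathcal{L}_\infty(\Theta_n)=0$.
   Context: $\mathbb{N}=\{1,2,\dots\}$, $\mathbb{N}_0=\{0,1,2,\dots\}$. Fix $H\in\mathbb{N}$, $\alpha\in\mathbb{R}$. For $r\in[1,\infty)$, $x\in\mathbb{R}$ let $\sigma_r(x)=r^{-1}\ln(1+r^{-1}e^{rx})$, and let $\sigma_\infty(x)=\max\{x,0\}$. For $r\in[1,\infty]$, $\phi=(\phi_1,\dots,\phi_{3H+1})\in\mathbb{R}^{3H+1}$, $x\in\mathbb{R}$ let $\mathscr{N}_r^{\phi}(x)=\phi_{3H+1}+\sum_{j=1}^{H}\phi_{2H+j}\,\sigma_r(\phi_jx+\phi_{H+j})$ and $\mathcal{L}_r(\phi)=\int_0^1(\mathscr{N}_r^{\phi}(y)-\alpha)^2\,dy$. The function $\mathcal{G}\colon\mathbb{R}^{3H+1}\to\mathbb{R}^{3H+1}$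 satisfies $\mathcal{G}(\phi)=\lim_{r\to\infty}(\nabla\mathcal{L}_r)(\phi)$ for every $\phi$ for which the sequence $((\nabla\mathcal{L}_r)(\phi))_{r\in\mathbb{N}}$ converges. $\|\cdot\|$ is the Euclidean norm. $V\colon\mathbb{R}^{3H+1}\to\mathbb{R}$ is given by $V(\phi)=\|\phi\|^2+(\phi_{3H+1}-2\alpha)^2$. *)

(* Defs.v *)
From HB Require Import structures.
From mathcomp Require Export all_boot all_order all_algebra.
From mathcomp Require Export all_classical all_reals all_analysis.

Set Implicit Arguments.
Unset Strict Implicit.
Unset Printing Implicit Defensive.

Export Order.TTheory GRing.Theory Num.Theory.
Export numFieldNormedType.Exports.

Local Open Scope classical_set_scope.
Local Open Scope ring_scope.

(* The parameter r ranges over [1, +oo] and is encoded in \bar R; values of r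
   outside that range (in particular -oo) are irrelevant. *)
Definition sigma (R : realType) (r : \bar R) (x : R) : R :=
  match r with
  | r'%:E => r'^-1 * ln (1 + r'^-1 * expR (r' * x))
  | +oo%E => Num.max x 0
  | -oo%E => 0
  end.

(* R^(3H+1); the entry phi_k of the mathematics, with k in {1, ..., 3H+1}, is
   the matrix entry of index k - 1. *)
Notation params R H := 'rV[R]_((3 * H).+1).

Definition entry (R : realType) (H : nat) (phi : params R H) (k : nat) : R :=
  phi 0 (inord k.-1).

Definition network (R : realType) (H : nat) (r : \bar R) (phi : params R H)
    (x : R) : R :=
  entry phi (3 * H + 1) +
  \sum_(1 <= j < H.+1)
    entry phi (2 * H + j) * sigma r (entry phi j * x + entry phi (H + j)).

Definition risk (R : realType) (H : nat) (alpha : R) (r : \bar R)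
    (phi : params R H) : R :=
  \int[lebesgue_measure]_(y in `[0, 1]) (network r phi y - alpha) ^+ 2.

Definition gradient (R : realType) (n : nat) (f : 'rV[R]_n.+1 -> R)
    (x : 'rV[R]_n.+1) : 'rV[R]_n.+1 :=
  \row_i 'D_(delta_mx 0 i) f x.

(* The library's norm on matrices is the maximum norm, hence this definition. *)
Definition enorm (R : realType) (n : nat) (x : 'rV[R]_n) : R :=
  Num.sqrt (\sum_i x 0 i ^+ 2).

(* The sequence indexed by r = 1, 2, ...; its n-th term has r = n + 1. *)
Definition grad_risk_seq (R : realType) (H : nat) (alpha : R)
    (phi : params R H) : nat -> params R H :=
  fun n => gradient (risk alpha n.+1%:R%:E) phi.

Definition is_generalized_gradient (R : realType) (H : nat) (alpha : R)
    (G : params R H -> params R H) : Prop :=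
  forall phi : params R H,
    cvgn (grad_risk_seq alpha phi) -> G phi = limn (grad_risk_seq alpha phi).

Definition lyapunov (R : realType) (H : nat) (alpha : R) (phi : params R H) : R :=
  enorm phi ^+ 2 + (entry phi (3 * H + 1) - 2 * alpha) ^+ 2.

(* Main.v *)
(* The gradients of the smoothed risks converge at every parameter phi:
   differentiating under the integral sign and letting r tend to infinity by
   dominated convergence, the u-component of the limit is
     T(u) = int_0^1 2 (N(y) - alpha) A_phi(u, y) dy,
   with A_phi linear in u and the indicator of (0, +oo) as derivative of the
   ReLU function. By positive homogeneity A_phi(phi, y) = 2 N(y) - phi_{3H+1},
   so grad V (phi) . G(phi) = 8 L(phi), and a pointwise AM-GM inequality gives
     |G(phi)|^2 + G_{3H+1}(phi)^2 <= 8 (1 + |phi|^2) L(phi).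
   As V is quadratic, one step changes it by at most
   - 8 gamma (1 - gamma (1 + V)) L <= - 4 gamma L, so V decreases along the
   iteration and the risks are summable. *)

Require Import Defs.
From mathcomp Require Import all_boot all_order all_algebra.
From mathcomp Require Import all_classical all_reals all_analysis.
From mathcomp Require Import measurable_realfun zify ring lra.

Set Implicit Arguments.
Unset Strict Implicit.
Unset Printing Implicit Defensive.

Local Open Scope classical_set_scope.
Local Open Scope ring_scope.

(** * Bounded functions and bounded convergence on the unit interval *)

Local Notation unit_itv R := (`[0, 1]%classic : set R).

Local Notation unit_integrable f :=
  (lebesgue_measure.-integrable (unit_itv _) (EFin \o f)).

(** The domain is an arbitrary type, so that sets of pairs express bounds uniform in an index [n] or
    in a parameter [t]. *)
Definition bounded_over {R : realType} {T : Type} (A : set T) (f : T -> R) :=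
  exists C, forall x, A x -> `|f x| <= C.

Lemma bounded_over_cst {R : realType} {T : Type} (A : set T) (c : R) :
  bounded_over A (fun=> c).
Proof. by exists `|c|. Qed.

Lemma bounded_overD {R : realType} {T : Type} (A : set T) (f g : T -> R) :
  bounded_over A f -> bounded_over A g ->
  bounded_over A (fun x => f x + g x).
Proof.
move=> [B fB] [C gC]; exists (B + C) => x Ax.
by rewrite (le_trans (ler_normD _ _))// lerD ?fB ?gC.
Qed.

Lemma bounded_overM {R : realType} {T : Type} (A : set T) (f g : T -> R) :
  bounded_over A f -> bounded_over A g ->
  bounded_over A (fun x => f x * g x).
Proof.
move=> [B fB] [C gC]; exists (B * C) => x Ax.
by rewrite normrM ler_pM ?fB ?gC.
Qed.

Lemma bounded_over_integrable {R : realType} (f : R -> R) :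
  measurable_fun setT f -> bounded_over (unit_itv R) f ->
  lebesgue_measure.-integrable (unit_itv R) (EFin \o f).
Proof.
move=> mf [C fC]; apply: measurable_bounded_integrable.
- exact: measurable_itv.
- by rewrite /= lebesgue_measure_itv /= lte_fin ltr01 oppr0 adde0 ltry.
- exact: measurable_funTS.
- by exists C; split; [exact: num_real|move=> x Cx y /fC/le_trans; apply; exact: ltW].
Qed.

(* The hypotheses of the bounded convergence theorem on [0, 1]. *)
Definition bounded_cvg {R : realType} (F : nat -> R -> R) (f : R -> R) :=
  [/\ forall n, measurable_fun setT (F n),
      bounded_over [set p : nat * R | unit_itv R p.2] (fun p => F p.1 p.2) &
      forall y, F n y @[n --> \oo] --> f y].

Lemma bounded_cvg_stat {R : realType} (f : R -> R) :
  measurable_fun setT f -> bounded_over (unit_itv R) f ->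
  bounded_cvg (fun=> f) f.
Proof.
move=> mf [C fC]; split => //; last by move=> y; exact: cvg_cst.
by exists C => -[n y] /= /fC.
Qed.

Lemma bounded_cvg_const {R : realType} (c : R) :
  bounded_cvg (fun _ _ => c) (fun=> c).
Proof.
by apply: bounded_cvg_stat; [exact: measurable_cst|exact: bounded_over_cst].
Qed.

Lemma bounded_cvgD {R : realType} (F G : nat -> R -> R) (f g : R -> R) :
  bounded_cvg F f -> bounded_cvg G g ->
  bounded_cvg (fun n y => F n y + G n y) (fun y => f y + g y).
Proof.
move=> [mF bF cF] [mG bG cG]; split.
- by move=> n; exact: measurable_funD.
- exact: bounded_overD.
- by move=> y; apply: cvgD.
Qed.

Lemma bounded_cvgM {R : realType} (F G : nat -> R -> R) (f g : R -> R) :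
  bounded_cvg F f -> bounded_cvg G g ->
  bounded_cvg (fun n y => F n y * G n y) (fun y => f y * g y).
Proof.
move=> [mF bF cF] [mG bG cG]; split.
- by move=> n; exact: measurable_funM.
- exact: bounded_overM.
- by move=> y; apply: cvgM.
Qed.

Lemma bounded_cvg_sum {R : realType} {I : Type} (s : seq I)
    (F : I -> nat -> R -> R) (f : I -> R -> R) :
  (forall i, bounded_cvg (F i) (f i)) ->
  bounded_cvg (fun n y => \sum_(i <- s) F i n y) (fun y => \sum_(i <- s) f i y).
Proof.
move=> Ff; elim: s => [|i s IH].
  have := bounded_cvg_const (0 : R); congr bounded_cvg.
    by apply/funext => n; apply/funext => y; rewrite big_nil.
  by apply/funext => y; rewrite big_nil.
have := bounded_cvgD (Ff i) IH; congr bounded_cvg.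
  by apply/funext => n; apply/funext => y; rewrite big_cons.
by apply/funext => y; rewrite big_cons.
Qed.

Lemma bounded_cvg_measurable {R : realType} (F : nat -> R -> R) (f : R -> R) :
  bounded_cvg F f -> measurable_fun (unit_itv R) f.
Proof.
move=> [mF _ cF]; apply: (@measurable_fun_cvg _ _ _ _ F).
- by move=> n; apply: measurable_funTS; exact: mF.
- by move=> y _; exact: cF.
Qed.

(** Dominated convergence with a constant majorant. The integrability of the limit is recorded as
    well, since it later allows integrals at [r = +oo] to be split. *)
Lemma bounded_cvg_integral {R : realType} (F : nat -> R -> R) (f : R -> R) :
  bounded_cvg F f ->
  lebesgue_measure.-integrable (unit_itv R) (EFin \o f) /\
  \int[lebesgue_measure]_(y in `[0, 1]) F n y @[n --> \oo] -->
  \int[lebesgue_measure]_(y in `[0, 1]) f y.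
Proof.
move=> Ff; have [mF [C FC] cF] := Ff.
have := @dominated_convergence _ _ R lebesgue_measure (unit_itv R)
  (measurable_itv _) (fun n => EFin \o F n) (EFin \o f) (EFin \o cst C).
case.
- by move=> n; apply/measurable_EFinP; apply: measurable_funTS; exact: mF.
- by apply/measurable_EFinP; exact: bounded_cvg_measurable Ff.
- by apply/aeW => y _; apply: cvg_EFin; [exact: nearW|exact: cF].
- apply: bounded_over_integrable; first exact: measurable_cst.
  exact: bounded_over_cst.
- by apply/aeW => y n Dy; rewrite lee_fin; exact: (FC (n, y)).
move=> fi _ Fcvg; split => //; rewrite /Rintegral.
apply: fine_cvg; rewrite fineK//.
by apply: integrable_fin_num => //; exact: measurable_itv.
Qed.

(** * Differentiation under the integral sign *)

(* The hypotheses of differentiation under the integral sign on [0, 1], at t = 0: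
   F' t y is the derivative in t of F t y. *)
Definition bounded_diff {R : realType} (F F' : R -> R -> R) :=
  [/\ forall t, measurable_fun setT (F t),
      bounded_over [set p : R * R | `]-1, 1[%classic p.1 /\ unit_itv R p.2]
        (fun p => F p.1 p.2),
      bounded_over [set p : R * R | `]-1, 1[%classic p.1 /\ unit_itv R p.2]
        (fun p => F' p.1 p.2) &
      forall t y : R, is_derive t 1 (F ^~ y) (F' t y)].

Lemma bounded_diff_stat {R : realType} (f : R -> R) :
  measurable_fun setT f -> bounded_over (unit_itv R) f ->
  bounded_diff (fun=> f) (fun _ _ => 0).
Proof.
move=> mf [C fC]; split => //.
- by exists C => -[n y] /= [_ /fC].
- exact: bounded_over_cst.
- by move=> t y; exact: is_derive_cst.
Qed.

Lemma bounded_diff_const {R : realType} (c : R) :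
  bounded_diff (fun _ _ => c) (fun _ _ => 0).
Proof.
by apply: bounded_diff_stat; [exact: measurable_cst|exact: bounded_over_cst].
Qed.

(** Describes one entry of [phi] moved along the line [t *: u + phi]; the bound uses [|t| < 1]. *)
Lemma bounded_diff_affine {R : realType} (a b : R) :
  bounded_diff (fun t _ => t * a + b) (fun _ _ => a).
Proof.
split.
- by move=> t; exact: measurable_cst.
- exists (`|a| + `|b|) => -[t y] /= [+ _].
  rewrite in_itv/= => /andP[t1 t2].
  rewrite (le_trans (ler_normD _ _))// lerD// normrM ler_piMl// ler_norml.
  by rewrite !ltW.
- exact: bounded_over_cst.
- move=> t y; apply: is_derive_eq.
  by rewrite /GRing.scale/=; ring.
Qed.

Lemma bounded_diffD {R : realType} (F F' G G' : R -> R -> R) :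
  bounded_diff F F' -> bounded_diff G G' ->
  bounded_diff (fun t y => F t y + G t y) (fun t y => F' t y + G' t y).
Proof.
move=> [mF bF bF' dF] [mG bG bG' dG]; split.
- by move=> t; exact: measurable_funD.
- exact: bounded_overD.
- exact: bounded_overD.
- by move=> t y; exact: is_deriveD (dF t y) (dG t y).
Qed.

Lemma bounded_diffM {R : realType} (F F' G G' : R -> R -> R) :
  bounded_diff F F' -> bounded_diff G G' ->
  bounded_diff (fun t y => F t y * G t y)
               (fun t y => F' t y * G t y + F t y * G' t y).
Proof.
move=> [mF bF bF' dF] [mG bG bG' dG]; split.
- by move=> t; exact: measurable_funM.
- exact: bounded_overM.
- by apply: bounded_overD; exact: bounded_overM.
- move=> t y; apply: (is_derive_eq (is_deriveM (dF t y) (dG t y))).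
  by rewrite /GRing.scale/=; ring.
Qed.

Lemma bounded_diff_sum {R : realType} {I : Type} (s : seq I)
    (F F' : I -> R -> R -> R) :
  (forall i, bounded_diff (F i) (F' i)) ->
  bounded_diff (fun t y => \sum_(i <- s) F i t y)
               (fun t y => \sum_(i <- s) F' i t y).
Proof.
move=> FF'; elim: s => [|i s IH].
  have := bounded_diff_const (0 : R).
  by congr bounded_diff; apply/funext => t; apply/funext => y; rewrite big_nil.
have := bounded_diffD (FF' i) IH.
by congr bounded_diff; apply/funext => t; apply/funext => y; rewrite big_cons.
Qed.

(** Dominated differentiation near 0 with a constant majorant. The conclusion stays a difference
    quotient because a directional derivative unfolds to one. *)
Lemma bounded_diff_integral {R : realType} (F F' : R -> R -> R) :
  bounded_diff F F' ->
  h^-1 *: (\int[lebesgue_measure]_(y in `[0, 1]) F h y -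
           \int[lebesgue_measure]_(y in `[0, 1]) F 0 y) @[h --> 0^'] -->
  \int[lebesgue_measure]_(y in `[0, 1]) F' 0 y.
Proof.
move=> [mF [B FB] [C F'C] dF].
have dE t y : partial1of2 F t y = F' t y.
  by rewrite partial1of2E; apply: (@derive_val _ _ _ _ _ _ _ (dF t y)).
have I0 : `]-1, 1[%classic (0 : R) by rewrite /= in_itv/= ltrN10 ltr01.
have C0 : 0 <= C.
  apply: le_trans (F'C (0, 0) _) => //.
  by split; [exact: I0|rewrite /= in_itv/= lexx ler01].
rewrite (_ : (fun y => F' 0 y) = partial1of2 F 0); last by apply/funext => y; rewrite dE.
have : h^-1 *: (\int[lebesgue_measure]_(y in `[0, 1]) F (h + 0) y -
    \int[lebesgue_measure]_(y in `[0, 1]) F 0 y) @[h --> 0^'] -->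
    \int[lebesgue_measure]_(y in `[0, 1]) partial1of2 F 0 y.
  apply: (@cvg_differentiation_under_integral R _ _ lebesgue_measure F
    (unit_itv R) (measurable_itv _) 0 (-1) 1 I0 _ _ (cst C)) => //.
  - move=> t It; apply: bounded_over_integrable => //.
    by exists B => y Iy; exact: (FB (t, y)).
  - apply: bounded_over_integrable; first exact: measurable_cst.
    exact: bounded_over_cst.
  - by move=> t y It Iy; rewrite dE; exact: (F'C (t, y)).
by under eq_fun do rewrite addr0.
Qed.

(** * The smoothed activation: bounds, derivative and limits *)

(* Derivative of sigma in x for finite r; its pointwise limit for r = +oo, which
   takes the value 0 at the kink x = 0. *)
Definition dsigma {R : realType} (r : \bar R) (x : R) : R :=
  match r with
  | r'%:E => expR (r' * x) / (r' + expR (r' * x))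
  | +oo%E => ((0 < x)%R)%:R
  | -oo%E => 0
  end.

Lemma sigma_arg_gt0 {R : realType} (r x : R) :
  0 < r -> 0 < 1 + r^-1 * expR (r * x).
Proof. by move=> r0; rewrite addr_gt0// mulr_gt0 ?invr_gt0 ?expR_gt0. Qed.

Lemma sigma_ge0 {R : realType} (r x : R) : 0 < r -> 0 <= sigma r%:E x.
Proof.
move=> r0; rewrite /sigma mulr_ge0 ?invr_ge0 ?(ltW r0)// ln_ge0// lerDl.
by rewrite mulr_ge0 ?invr_ge0 ?(ltW r0) ?expR_ge0.
Qed.

(** With [m = max(x, 0)], both summands inside the logarithm are at most [exp(r m)], and [2 <= e];
    hence the logarithm is at most [1 + r m]. *)
Lemma sigma_le {R : realType} (r x : R) : 1 <= r ->
  sigma r%:E x <= r^-1 + Num.max x 0.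
Proof.
move=> r1; have r0 : 0 < r by exact: lt_le_trans r1.
set m := Num.max x 0.
have m0 : 0 <= m by rewrite le_max lexx orbT.
have xm : x <= m by rewrite le_max lexx.
have -> : r^-1 + m = r^-1 * (1 + r * m) by field; rewrite gt_eqF.
rewrite /sigma ler_pM2l ?invr_gt0// -[leRHS]expRK ler_ln ?posrE ?expR_gt0//; last first.
  exact: sigma_arg_gt0.
have e1 : 1 <= expR (r * m) by rewrite -expR0 ler_expR mulr_ge0// ltW.
have ex : r^-1 * expR (r * x) <= expR (r * m).
  rewrite -[leRHS]mul1r ler_pM ?invr_ge0 ?(ltW r0) ?expR_ge0 ?invf_le1//.
  by rewrite ler_expR ler_pM2l.
rewrite expRD; have := @expR_ge1Dx R 1; nra.
Qed.

(** The bound does not depend on [r], so one majorant serves the whole sequence. *)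
Lemma norm_sigma_le {R : realType} (r x : R) : 1 <= r ->
  `|sigma r%:E x| <= 1 + `|x|.
Proof.
move=> r1; have r0 : 0 < r by exact: lt_le_trans r1.
rewrite ger0_norm ?sigma_ge0// (le_trans (sigma_le _ r1))// lerD ?invf_le1//.
by rewrite ge_max ler_norm normr_ge0.
Qed.

Lemma is_derive_sigma {R : realType} (r x : R) : 0 < r ->
  is_derive x 1 (sigma r%:E) (dsigma r%:E x).
Proof.
move=> r0; have a0 := sigma_arg_gt0 x r0.
have dl := is_derive1_ln a0.
have dm : is_derive x (1 : R) (fun x => r * x) r.
  by apply: is_derive_eq; rewrite /GRing.scale/= mulr1.
have de := is_derive1_comp (is_derive_expR (r * x)) dm.
have da : is_derive x (1 : R) (fun x => 1 + r^-1 * expR (r * x))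
    (expR (r * x)).
  apply: is_derive_eq; rewrite /GRing.scale/=; field; rewrite gt_eqF//.
have dla := is_derive1_comp (f := @ln R) (g := fun x => 1 + r^-1 * expR (r * x)) dl da.
have := is_deriveM (is_derive_cst (r^-1 : R) x (1 : R)) dla.
move=> h; apply: (is_derive_eq h).
rewrite /dsigma /GRing.scale/= /cst; field.
by rewrite !gt_eqF ?addr_gt0 ?expR_gt0.
Qed.

Lemma dsigma_itv {R : realType} (r x : R) : 0 < r -> 0 <= dsigma r%:E x <= 1.
Proof.
move=> r0; have e0 := expR_gt0 (r * x); rewrite /dsigma.
have s0 : 0 < r + expR (r * x) by rewrite addr_gt0.
by rewrite divr_ge0 ?(ltW e0) ?(ltW s0)//= ler_pdivrMr// mul1r lerDr ltW.
Qed.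

Lemma norm_dsigma_le1 {R : realType} (r x : R) : 0 < r -> `|dsigma r%:E x| <= 1.
Proof. by move=> /(dsigma_itv x)/andP[d0 d1]; rewrite ger0_norm. Qed.

Lemma measurable_sigma {R : realType} (r : R) :
  measurable_fun setT (sigma r%:E).
Proof.
apply: measurable_funM; first exact: measurable_cst.
apply: measurableT_comp; first exact: measurable_ln.
apply: measurable_funD; first exact: measurable_cst.
apply: measurable_funM; first exact: measurable_cst.
apply: measurableT_comp; first exact: measurable_expR.
by apply: measurable_funM; [exact: measurable_cst|exact: measurable_id].
Qed.

Lemma measurable_dsigma {R : realType} (r : R) : 0 < r ->
  measurable_fun setT (dsigma r%:E).
Proof.
move=> r0; apply: continuous_measurable_fun => x.
have ce : expR (r * y) @[y --> x] --> expR (r * x).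
  apply: (@continuous_comp _ _ _ (fun y => r * y) expR); last exact: continuous_expR.
  by apply: cvgM; [exact: cvg_cst|exact: cvg_id].
apply: cvgM => //; apply: cvgV.
  by rewrite gt_eqF// addr_gt0 ?expR_gt0.
by apply: cvgD => //; exact: cvg_cst.
Qed.

(** A squeeze with radius [2 q], where [q = r^(-1/2)]. The upper bound has error
    [r^-1 = q^2 <= 2 q]; for [x > 0] the lower bound [x - r^-1 ln r] requires control of [ln r]. *)
Lemma sigma_cvg {R : realType} (x : R) :
  sigma n.+1%:R%:E x @[n --> \oo] --> sigma +oo%E x.
Proof.
have q_cvg : 2 * Num.sqrt n.+1%:R^-1 @[n --> \oo] --> (0 : R).
  rewrite (_ : 0 = 2 * Num.sqrt 0); last by rewrite sqrtr0 mulr0.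
  apply: cvgM; first exact: cvg_cst.
  by apply: cvg_comp; [exact: cvg_harmonic|exact: sqrt_continuous].
have d_cvg (s : R) : sigma +oo%E x + s * (2 * Num.sqrt n.+1%:R^-1) @[n --> \oo]
    --> sigma +oo%E x.
  rewrite -{2}[sigma _ x]addr0 -[in X in _ --> X](mulr0 s).
  by apply: cvgD; [exact: cvg_cst|apply: cvgM => //; exact: cvg_cst].
apply: (squeeze_cvgr _ (d_cvg (-1)) (d_cvg 1)); apply: nearW => n.
set r := (n.+1%:R : R).
have r1 : 1 <= r by rewrite /r ler1n.
have r0 : 0 < r by exact: lt_le_trans r1.
set q := Num.sqrt r^-1.
have q0 : 0 < q by rewrite sqrtr_gt0 invr_gt0.
have qE : q ^+ 2 = r^-1 by rewrite sqr_sqrtr// invr_ge0 ltW.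
have rE : r = q^-1 ^+ 2 by rewrite exprVn qE invrK.
have r_le1 : r^-1 <= 1 by rewrite invf_le1.
have q1 : q <= 1 by rewrite -(@expr_le1 _ 2) ?qE// ltW.
apply/andP; split; last first.
  rewrite (le_trans (sigma_le _ r1))//= -qE; nra.
have [x0|x0] := lerP x 0.
  rewrite /= (max_r x0) (le_trans _ (sigma_ge0 _ r0))//; nra.
rewrite /= (max_l (ltW x0)).
(* Since [r = q^-2], [ln r = 2 ln q^-1 <= 2 (q^-1 - 1)], which gives [r^-1 ln r <= 2 q]. *)
have lnr : ln r <= 2 * q^-1.
  have qV0 : 0 < q^-1 by rewrite invr_gt0.
  have : ln q^-1 <= q^-1 - 1.
    rewrite -[in leLHS](subrK 1 q^-1) [in leLHS]addrC.
    by apply: le_ln1Dx; lra.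
  by rewrite rE lnXn// mulr2n; lra.
apply: (@le_trans _ _ (r^-1 * (r * x - ln r))).
  rewrite mulrBr mulKf ?gt_eqF// lerD2l mulN1r lerN2 -qE.
  apply: le_trans (_ : q ^+ 2 * (2 * q^-1) <= _).
    by rewrite ler_pM2l// exprn_gt0.
  by rewrite (_ : q ^+ 2 * (2 * q^-1) = 2 * q)//; field; rewrite gt_eqF.
rewrite ler_pM2l ?invr_gt0//.
(* The left side is the logarithm with the summand 1 dropped. *)
have -> : r * x - ln r = ln (r^-1 * expR (r * x)).
  by rewrite lnM ?posrE ?invr_gt0 ?expR_gt0// lnV ?posrE// expRK addrC.
rewrite ler_ln ?posrE ?lerDr// ?sigma_arg_gt0//.
by rewrite mulr_gt0 ?invr_gt0 ?expR_gt0.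
Qed.

(** For [x <= 0] the exponential is at most 1, so the derivative is at most [r^-1]; this includes
    the kink. For [x > 0] the defect [r / (r + e)], with [e = exp(r x)], is at most [2 / (r x^2)]
    because [e >= (r x)^2 / 2]. *)
Lemma dsigma_cvg {R : realType} (x : R) :
  dsigma n.+1%:R%:E x @[n --> \oo] --> dsigma +oo%E x.
Proof.
have h_cvg (b s : R) : b + s * n.+1%:R^-1 @[n --> \oo] --> b.
  rewrite -{2}[b]addr0 -[in X in _ --> X](mulr0 s).
  apply: cvgD; first exact: cvg_cst.
  by apply: cvgM; [exact: cvg_cst|exact: cvg_harmonic].
have n0 (n : nat) : 0 < n.+1%:R :> R by rewrite ltr0n.
have [x0|x0] := lerP x 0.
  rewrite /dsigma ltNge x0/=.
  apply: (squeeze_cvgr _ (cvg_cst (0 : R)) (h_cvg 0 1)); apply: nearW => n.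
  have /andP[-> _] /= := dsigma_itv x (n0 n).
  have e0 := expR_gt0 (n.+1%:R * x); have r0 := n0 n.
  rewrite add0r mul1r ler_pdivrMr ?addr_gt0// mulrDr mulVf ?gt_eqF//.
  have : expR (n.+1%:R * x) <= 1 by rewrite -expR0 ler_expR pmulr_rle0.
  move=> /le_trans; apply; rewrite lerDl mulr_ge0// ?invr_ge0 ltW//.
rewrite /= x0/=.
apply: (squeeze_cvgr _ (h_cvg 1 (- (2 / x ^+ 2))) (cvg_cst (1 : R))).
apply: nearW => n.
have /andP[_ ->] /= := dsigma_itv x (n0 n); rewrite andbT.
have r0 := n0 n; move: (n.+1%:R) r0 => r r0.
have rx0 : 0 < r * x by rewrite mulr_gt0.
have := expR_ge1Dxn 1 (ltW rx0); set e := expR _ => he.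
have e0 : 0 < e by rewrite expR_gt0.
have {}he : (r * x) ^+ 2 / 2 <= e by apply: le_trans he; rewrite lerDr.
rewrite ler_pdivlMr ?addr_gt0//.
rewrite -(ler_pM2l (_ : 0 < r * x ^+ 2)) ?mulr_gt0 ?exprn_gt0//.
have -> : r * x ^+ 2 * ((1 + - (2 / x ^+ 2) / r) * (r + e)) =
  (r * x ^+ 2 - 2) * (r + e) by field; rewrite !gt_eqF.
have : r * ((r * x) ^+ 2 / 2) <= r * e by rewrite ler_pM2l.
rewrite exprMn; lra.
Qed.

(** * Limits and derivatives of the realization *)

Lemma bounded_over_id {R : realType} : bounded_over (unit_itv R) id.
Proof.
by exists 1 => y /=; rewrite in_itv/= => /andP[y0 y1]; rewrite ger0_norm.
Qed.

Lemma bounded_cvg_sigma {R : realType} (z : R -> R) :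
  measurable_fun setT z -> bounded_over (unit_itv R) z ->
  bounded_cvg (fun n y => sigma n.+1%:R%:E (z y)) (fun y => sigma +oo%E (z y)).
Proof.
move=> mz [C zC]; split.
- by move=> n; apply: measurableT_comp => //; exact: measurable_sigma.
- exists (1 + C) => -[n y] /= Iy.
  by rewrite (le_trans (norm_sigma_le _ _)) ?ler1n// lerD2l zC.
- by move=> y; exact: sigma_cvg.
Qed.

Lemma bounded_cvg_dsigma {R : realType} (z : R -> R) :
  measurable_fun setT z -> bounded_over (unit_itv R) z ->
  bounded_cvg (fun n y => dsigma n.+1%:R%:E (z y)) (fun y => dsigma +oo%E (z y)).
Proof.
move=> mz [C zC]; split.
- by move=> n; apply: measurableT_comp => //; exact: measurable_dsigma.
- by exists 1 => -[n y] /= Iy; rewrite norm_dsigma_le1.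
- by move=> y; exact: dsigma_cvg.
Qed.

Lemma bounded_diff_sigma {R : realType} (r : R) (F F' : R -> R -> R) : 1 <= r ->
  bounded_diff F F' ->
  bounded_diff (fun t y => sigma r%:E (F t y))
               (fun t y => dsigma r%:E (F t y) * F' t y).
Proof.
move=> r1 [mF [C FC] bF' dF]; have r0 : 0 < r by exact: lt_le_trans r1.
split.
- by move=> t; apply: measurableT_comp => //; exact: measurable_sigma.
- exists (1 + C) => p Ip.
  by rewrite (le_trans (norm_sigma_le _ _))// lerD2l FC.
- apply: bounded_overM => //.
  by exists 1 => p _; rewrite norm_dsigma_le1.
- by move=> t y; exact: (is_derive1_comp (is_derive_sigma (F t y) r0) (dF t y)).
Qed.

(** The shape [a *: u + v] covers lines through [phi], linear combinations of directions and
    gradient steps alike. *)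
Lemma entryD {R : realType} {H : nat} (a : R) (u v : params R H) (k : nat) :
  entry (a *: u + v) k = a * entry u k + entry v k.
Proof. by rewrite /entry !mxE. Qed.

(* Derivative of the realization at phi in the direction u. *)
Definition dnetwork {R : realType} {H : nat} (r : \bar R) (phi u : params R H)
    (y : R) : R :=
  entry u (3 * H + 1) +
  \sum_(1 <= j < H.+1)
    (entry u (2 * H + j) * sigma r (entry phi j * y + entry phi (H + j)) +
     entry phi (2 * H + j) *
       (dsigma r (entry phi j * y + entry phi (H + j)) *
        (entry u j * y + entry u (H + j)))).

Lemma bounded_diff_network {R : realType} {H : nat} (r : R)
    (phi u : params R H) : 1 <= r ->
  bounded_diff (fun t y => network r%:E (t *: u + phi) y)
               (fun t y => dnetwork r%:E (t *: u + phi) u y).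
Proof.
move=> r1.
have affE k := @bounded_diff_affine R (entry u k) (entry phi k).
have idE := bounded_diff_stat (@measurable_id _ R setT) bounded_over_id.
pose z j t y := (t * entry u j + entry phi j) * y +
                (t * entry u (H + j)%N + entry phi (H + j)%N).
(* The input [y] is a factor constant in [t], so the product rule leaves a summand multiplied by 0,
   which is cleared at the end. *)
have zE j : bounded_diff (z j)
    (fun t y => entry u j * y + (t * entry u j + entry phi j) * 0 + entry u (H + j)).
  by apply: bounded_diffD => //; exact: bounded_diffM.
have := bounded_diffD (affE (3 * H + 1)%N)
  (bounded_diff_sum (index_iota 1 H.+1) (fun j =>
     bounded_diffM (affE (2 * H + j)%N) (bounded_diff_sigma r1 (zE j)))).
congr bounded_diff; apply/funext => t; apply/funext => y.
  rewrite /network entryD; congr (_ + _).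
  by apply: eq_bigr => j _; rewrite !entryD.
rewrite /dnetwork; congr (_ + _).
by apply: eq_bigr => j _; rewrite !entryD mulr0 addr0.
Qed.

Lemma bounded_cvg_network {R : realType} {H : nat} (phi : params R H) :
  bounded_cvg (fun n y => network n.+1%:R%:E phi y) (network +oo%E phi).
Proof.
have cstE := @bounded_cvg_const R.
apply: bounded_cvgD => //; apply: bounded_cvg_sum => j.
apply: bounded_cvgM => //; apply: bounded_cvg_sigma.
  by apply: measurable_funD => //; exact: measurable_funM.
apply: bounded_overD; last exact: bounded_over_cst.
by apply: bounded_overM; [exact: bounded_over_cst|exact: bounded_over_id].
Qed.

Lemma bounded_cvg_dnetwork {R : realType} {H : nat} (phi u : params R H) :
  bounded_cvg (fun n y => dnetwork n.+1%:R%:E phi u y) (dnetwork +oo%E phi u).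
Proof.
have cstE := @bounded_cvg_const R.
have m_aff (a b : R) : measurable_fun setT (fun y => a * y + b).
  by apply: measurable_funD => //; exact: measurable_funM.
have b_aff (a b : R) : bounded_over (unit_itv R) (fun y => a * y + b).
  apply: bounded_overD; last exact: bounded_over_cst.
  by apply: bounded_overM; [exact: bounded_over_cst|exact: bounded_over_id].
apply: bounded_cvgD => //; apply: bounded_cvg_sum => j.
apply: bounded_cvgD.
  by apply: bounded_cvgM => //; exact: bounded_cvg_sigma.
apply: bounded_cvgM => //; apply: bounded_cvgM.
  exact: bounded_cvg_dsigma.
exact: bounded_cvg_stat.
Qed.

(** * Gradients of the smoothed risks and their limit *)

(* T(u) for r = +oo, and the derivative of the risk at phi along u for finite r. *)
Definition risk_dir {R : realType} {H : nat} (alpha : R) (r : \bar R)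
    (phi u : params R H) : R :=
  \int[lebesgue_measure]_(y in `[0, 1])
    (2 * ((network r phi y - alpha) * dnetwork r phi u y)).

Lemma derive_risk {R : realType} {H : nat} (alpha r : R) (phi u : params R H) :
  1 <= r -> 'D_u (risk alpha r%:E) phi = risk_dir alpha r%:E phi u.
Proof.
move=> r1; have NE := bounded_diff_network phi u r1.
have DE := bounded_diffD NE (bounded_diff_const (- alpha)).
(* The square is differentiated as a product, which yields two equal summands; the base point
   [t = 0] is [phi] itself. *)
have := bounded_diff_integral (bounded_diffM DE DE).
rewrite scale0r add0r => h; apply/cvg_lim => //.
rewrite /risk_dir [X in _ --> X](_ : _ = \int[lebesgue_measure]_(y in `[0, 1])
  ((dnetwork r%:E phi u y + 0) * (network r%:E phi y - alpha) +
   (network r%:E phi y - alpha) * (dnetwork r%:E phi u y + 0))) //.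
by apply: eq_Rintegral => y _; ring.
Qed.

Lemma bounded_cvg_risk_dir {R : realType} {H : nat} (alpha : R)
    (phi u : params R H) :
  bounded_cvg
    (fun n y => 2 * ((network n.+1%:R%:E phi y - alpha) *
                     dnetwork n.+1%:R%:E phi u y))
    (fun y => 2 * ((network +oo%E phi y - alpha) * dnetwork +oo%E phi u y)).
Proof.
have cstE := @bounded_cvg_const R.
apply: bounded_cvgM => //; apply: bounded_cvgM.
  by apply: bounded_cvgD => //; exact: bounded_cvg_network.
exact: bounded_cvg_dnetwork.
Qed.

Lemma bounded_cvg_risk {R : realType} {H : nat} (alpha : R)
    (phi : params R H) :
  bounded_cvg (fun n y => (network n.+1%:R%:E phi y - alpha) ^+ 2)
              (fun y => (network +oo%E phi y - alpha) ^+ 2).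
Proof.
have cE := bounded_cvg_const (- alpha).
by apply: bounded_cvgM; apply: bounded_cvgD => //; exact: bounded_cvg_network.
Qed.

Lemma grad_risk_seq_cvg {R : realType} {H : nat} (alpha : R)
    (phi : params R H) :
  grad_risk_seq alpha phi @ \oo -->
    (\row_i risk_dir alpha +oo%E phi (delta_mx 0 i) : params R H).
Proof.
have c i : grad_risk_seq alpha phi n 0 i @[n --> \oo] -->
    risk_dir alpha +oo%E phi (delta_mx 0 i).
  have [_] := bounded_cvg_integral (bounded_cvg_risk_dir alpha phi (delta_mx 0 i)).
  apply: cvg_trans; apply: near_eq_cvg; apply: nearW => n.
  by rewrite /grad_risk_seq /gradient mxE derive_risk// ler1n.
apply/cvg_ballP => e e0.
(* Balls of row vectors are entrywise, and finitely many eventual properties hold simultaneously. *)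
have : \forall n \near \oo, forall i, ball (risk_dir alpha +oo%E phi (delta_mx 0 i)) e
    (grad_risk_seq alpha phi n 0 i).
  apply: filter_forall => i.
  by move/cvg_ballP : (c i); apply.
apply: filterS => n nP; split => // a i.
by rewrite ord1 mxE.
Qed.

Lemma generalized_gradientE {R : realType} {H : nat} (alpha : R)
    (G : params R H -> params R H) (phi : params R H) :
  is_generalized_gradient alpha G ->
  G phi = \row_i risk_dir alpha +oo%E phi (delta_mx 0 i).
Proof.
move=> GE; have c := @grad_risk_seq_cvg R H alpha phi.
rewrite GE; first exact: (cvg_lim (@norm_hausdorff _ _) c).
by apply/cvg_ex; eexists; exact: c.
Qed.

(** * Calculus of integrals over the unit interval *)

Lemma unit_integrableZl {R : realType} (f : R -> R) (a : R) :
  unit_integrable f -> unit_integrable (fun y => a * f y).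
Proof. by move=> fi; refine (integrableZl _ a fi); exact: measurable_itv. Qed.

Lemma unit_integrableD {R : realType} (f g : R -> R) :
  unit_integrable f -> unit_integrable g ->
  unit_integrable (fun y => f y + g y).
Proof. by move=> fi gi; refine (integrableD _ fi gi); exact: measurable_itv. Qed.

Lemma unit_RintegralZl {R : realType} (f : R -> R) (a : R) :
  unit_integrable f ->
  \int[lebesgue_measure]_(y in `[0, 1]) (a * f y) =
  a * \int[lebesgue_measure]_(y in `[0, 1]) f y.
Proof. by move=> fi; refine (RintegralZl a _ fi); exact: measurable_itv. Qed.

Lemma unit_RintegralD {R : realType} (f g : R -> R) :
  unit_integrable f -> unit_integrable g ->
  \int[lebesgue_measure]_(y in `[0, 1]) (f y + g y) =
  \int[lebesgue_measure]_(y in `[0, 1]) f y +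
  \int[lebesgue_measure]_(y in `[0, 1]) g y.
Proof. by move=> fi gi; refine (RintegralD _ fi gi); exact: measurable_itv. Qed.

Lemma le_unit_Rintegral {R : realType} (f g : R -> R) :
  unit_integrable f -> unit_integrable g ->
  (forall y, 0 <= y <= 1 -> f y <= g y) ->
  \int[lebesgue_measure]_(y in `[0, 1]) f y <=
  \int[lebesgue_measure]_(y in `[0, 1]) g y.
Proof.
move=> fi gi fg; refine (le_Rintegral _ fi gi _); first exact: measurable_itv.
by move=> y; rewrite /= in_itv/=; exact: fg.
Qed.

Lemma unit_Rintegral_cst {R : realType} (c : R) :
  \int[lebesgue_measure]_(y in `[0, 1]) c = c.
Proof.
rewrite Rintegral_cst; last exact: measurable_itv.
by rewrite /= lebesgue_measure_itv/= lte_fin ltr01 oppr0 adde0/= mulr1.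
Qed.

(** * Coordinates of the parameter space *)

(** The coordinates are cut into inner weights, inner biases, outer weights and the output bias,
    then regrouped by neuron, so that norms can be compared with the network sum term by term. *)
Lemma sum_entries {R : realType} {H : nat} (f : 'I_(3 * H).+1 -> R) :
  \sum_i f i = f (inord (3 * H)) + \sum_(1 <= j < H.+1)
    (f (inord j.-1) + f (inord (H + j).-1) + f (inord (2 * H + j).-1)).
Proof.
under eq_bigr do rewrite -[X in f X]inord_val.
rewrite -(big_mkord xpredT (fun k => f (inord k))) big_nat_recr//= addrC.
congr (_ + _).
rewrite (@big_cat_nat _ _ _ (2 * H)) ?leq_mul//=.
rewrite (@big_cat_nat _ _ _ H) ?leq_pmull//=.
rewrite big_add1/= !big_split/=; congr (_ + _ + _).
- rewrite -{1}[H]add0n big_addn mul2n -addnn addnK.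
  by apply: eq_bigr => j _; rewrite addnS addnC.
- rewrite -{1}[(2 * H)%N]add0n big_addn -mulnBl mul1n.
  by apply: eq_bigr => j _; rewrite addnS addnC.
Qed.

Lemma sqr_enorm {R : realType} (n : nat) (x : 'rV[R]_n) :
  enorm x ^+ 2 = \sum_i x 0 i ^+ 2.
Proof. by rewrite sqr_sqrtr// sumr_ge0// => i _; exact: sqr_ge0. Qed.

(** The unit vector of the output bias; multiples of it account for the extra square in the Lyapunov
    function. *)
Definition last_dir {R : realType} (H : nat) : params R H :=
  delta_mx 0 (inord (3 * H)).

Lemma entry_last_dir {R : realType} {H : nat} (k : nat) : (k <= 3 * H)%N ->
  (0 < k)%N -> entry (last_dir H : params R H) k = 0.
Proof.
case: k => // k kH _; rewrite /entry /last_dir mxE eqxx/= -val_eqE/= !inordK//.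
  by rewrite ltn_eqF.
by rewrite ltnS ltnW.
Qed.

Lemma entry_last_dir_last {R : realType} {H : nat} :
  entry (last_dir H : params R H) (3 * H + 1) = 1.
Proof. by rewrite /entry /last_dir addn1 mxE !eqxx. Qed.

(** * The limiting derivative as a linear form, and its Lyapunov identity *)

Lemma dnetwork_linear {R : realType} {H : nat} (r : \bar R) (phi u v : params R H)
    (a y : R) :
  dnetwork r phi (a *: u + v) y = a * dnetwork r phi u y + dnetwork r phi v y.
Proof.
rewrite /dnetwork entryD mulrDr mulr_sumr addrACA -big_split/=; congr (_ + _).
by apply: eq_bigr => j _; rewrite !entryD; ring.
Qed.

Lemma risk_dir_linear {R : realType} {H : nat} (alpha : R) (phi u v : params R H)
    (a : R) :
  risk_dir alpha +oo%E phi (a *: u + v) =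
  a * risk_dir alpha +oo%E phi u + risk_dir alpha +oo%E phi v.
Proof.
have [iu _] := bounded_cvg_integral (bounded_cvg_risk_dir alpha phi u).
have [iv _] := bounded_cvg_integral (bounded_cvg_risk_dir alpha phi v).
rewrite /risk_dir -unit_RintegralZl// -unit_RintegralD//; last first.
  exact: unit_integrableZl.
by apply: eq_Rintegral => y _; rewrite dnetwork_linear; ring.
Qed.

(** Linearity on the standard basis turns [risk_dir] into the inner product of [u] with the limiting
    gradient. *)
Lemma risk_dir_coord {R : realType} {H : nat} (alpha : R) (phi u : params R H) :
  risk_dir alpha +oo%E phi u =
  \sum_i u 0 i * risk_dir alpha +oo%E phi (delta_mx 0 i).
Proof.
rewrite [in LHS](row_sum_delta u).
elim/big_rec2 : _ => [|i s w _ <-]; last exact: risk_dir_linear.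
(* The value at the zero direction satisfies [T = T + T], so it vanishes. *)
have := risk_dir_linear alpha phi 0 0 1.
rewrite scale1r add0r mul1r; lra.
Qed.

(** Euler's identity: as [dsigma(z) z = sigma(z)] at [r = +oo], each neuron is homogeneous of degree
    2 in its three parameters, whereas the output bias has degree 1. *)
Lemma dnetwork_self {R : realType} {H : nat} (phi : params R H) (y : R) :
  dnetwork +oo%E phi phi y =
  2 * network +oo%E phi y - entry phi (3 * H + 1).
Proof.
rewrite /dnetwork /network mulrDr mulr_sumr addrAC mulr_natl mulr2n addrK.
congr (_ + _); apply: eq_bigr => j _.
rewrite /sigma /dsigma; set z := entry phi j * y + _.
by case: (ltrP 0 z) => z0; rewrite /=; ring.
Qed.

Lemma dnetwork_last_dir {R : realType} {H : nat} (r : \bar R) (phi : params R H)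
    (y : R) :
  dnetwork r phi (last_dir H) y = 1.
Proof.
rewrite /dnetwork entry_last_dir_last big_nat big1 ?addr0// => j /andP[j0 jH].
rewrite !entry_last_dir ?addn_gt0 ?j0 ?orbT//; last 3 first.
- lia.
- lia.
- lia.
by ring.
Qed.

(* The direction on the left is half the gradient of the Lyapunov function. *)
Lemma risk_dir_lyapunov {R : realType} {H : nat} (alpha : R) (phi : params R H) :
  risk_dir alpha +oo%E phi
    ((entry phi (3 * H + 1) - 2 * alpha) *: last_dir H + phi) =
  4 * risk alpha +oo%E phi.
Proof.
have [i1 _] := bounded_cvg_integral (bounded_cvg_risk alpha phi).
rewrite /risk_dir /risk -unit_RintegralZl//.
apply: eq_Rintegral => y _.
(* With [N] the realization and [p] the output bias, the derivative of [N] in this direction is [(p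
   - 2 alpha) + (2 N - p) = 2 (N - alpha)]. *)
by rewrite dnetwork_linear dnetwork_last_dir dnetwork_self; ring.
Qed.

(** * The bound of the gradient by the risk *)

(* Three instances of [2 a b <= a^2 / 2 + 2 b^2], one per parameter of the neuron. *)
Lemma neuron_bound {R : realType} (n y w b v uw ub uv : R) : 0 <= y <= 1 ->
  2 * (n * (uv * sigma +oo%E (w * y + b) +
            v * (dsigma +oo%E (w * y + b) * (uw * y + ub)))) <=
  2^-1 * (uw ^+ 2 + ub ^+ 2 + uv ^+ 2) +
  4 * n ^+ 2 * (w ^+ 2 + b ^+ 2 + v ^+ 2).
Proof.
move=> /andP[y0 y1].
have y2 : y ^+ 2 <= 1 by rewrite expr_le1.
have : 0 <= sigma +oo%E (w * y + b) /\
    (sigma +oo%E (w * y + b)) ^+ 2 <= 2 * (w ^+ 2 + b ^+ 2).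
  rewrite /=; case: (ltrP 0 (w * y + b)) => z0; last first.
    by split => //; rewrite expr0n/= mulr_ge0// addr_ge0 ?sqr_ge0.
  split; first exact: ltW.
  (* [(w y + b)^2 + (w y - b)^2 = 2 w^2 y^2 + 2 b^2], and [y^2 <= 1]. *)
  have := sqr_ge0 (w * y - b); have := mulr_ge0 (sqr_ge0 w) (_ : 0 <= 1 - y ^+ 2).
  by rewrite subr_ge0 => /(_ y2); lra.
move: (sigma _ _) => s [s0 s2].
have : 0 <= dsigma +oo%E (w * y + b) <= 1.
  by rewrite /=; case: (0 < _); rewrite /= ?lexx ler01.
move: (dsigma _ _) => d /andP[d0 d1].
have d2 : d ^+ 2 <= 1 by rewrite expr_le1.
have dy2 : d ^+ 2 * y ^+ 2 <= 1 by rewrite mulr_ile1 ?sqr_ge0.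
have h1 : 2 * (n * uv * s) <= 2^-1 * uv ^+ 2 + 2 * n ^+ 2 * s ^+ 2.
  by have := sqr_ge0 (uv - 2 * n * s); lra.
have h2 : 2 * (n * v * d * uw * y) <=
    2^-1 * uw ^+ 2 + 2 * (n ^+ 2 * v ^+ 2) * (d ^+ 2 * y ^+ 2).
  by have := sqr_ge0 (uw - 2 * n * v * d * y); lra.
have h3 : 2 * (n * v * d * ub) <= 2^-1 * ub ^+ 2 + 2 * (n ^+ 2 * v ^+ 2) * d ^+ 2.
  by have := sqr_ge0 (ub - 2 * n * v * d); lra.
have nv : 0 <= 2 * (n ^+ 2 * v ^+ 2) by rewrite mulr_ge0// mulr_ge0 ?sqr_ge0.
have n2 : 0 <= 2 * n ^+ 2 by rewrite mulr_ge0 ?sqr_ge0.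
(* The instance for [uv] yields [4 n^2 (w^2 + b^2)]; the other two yield [2 n^2 v^2] each. *)
have k1 := ler_wpM2l n2 s2.
have k2 := ler_wpM2l nv dy2; have k3 := ler_wpM2l nv d2.
by lra.
Qed.

Lemma dnetwork_bound {R : realType} {H : nat} (phi u : params R H) (n y : R) :
  0 <= y <= 1 ->
  2 * (n * dnetwork +oo%E phi (entry u (3 * H + 1) *: last_dir H + u) y) <=
  2^-1 * (enorm u ^+ 2 + entry u (3 * H + 1) ^+ 2) +
  4 * (1 + enorm phi ^+ 2) * n ^+ 2.
Proof.
move=> y01.
rewrite dnetwork_linear dnetwork_last_dir mulr1 !sqr_enorm !sum_entries.
rewrite /dnetwork /entry addn1/=.
set c := u 0 (inord (3 * H)); set p := phi 0 (inord (3 * H)).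
set S := \sum_(1 <= j < H.+1) _.
set U := \sum_(1 <= j < H.+1) _.
set P := \sum_(1 <= j < H.+1) _.
have SUP : 2 * (n * S) <= 2^-1 * U + 4 * n ^+ 2 * P.
  rewrite /S /U /P !mulr_sumr -big_split/=; apply: ler_sum => j _.
  exact: neuron_bound.
(* The direction doubles the output bias [c], contributing [4 n c <= c^2 + 4 n^2]. One half of [c^2]
   comes from the norm of [u], the other from the added square; [4 n^2] is the share of the 1 in
   [1 + |phi|^2]. *)
have := sqr_ge0 (c - 2 * n); have := mulr_ge0 (sqr_ge0 n) (sqr_ge0 p).
by lra.
Qed.

Lemma risk_ge0 {R : realType} {H : nat} (alpha : R) (r : \bar R)
    (phi : params R H) : 0 <= risk alpha r phi.
Proof. by apply: Rintegral_ge0 => y _; exact: sqr_ge0. Qed.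

(** As [g] represents the linear form, the left side [S] is the form evaluated at
    [c *: last_dir H + g]. Integrating the pointwise bound gives [S <= S / 2 + 4 (1 + |phi|^2) L],
    with [L] the risk, and [S / 2] is absorbed. *)
Lemma gradient_bound {R : realType} {H : nat} (alpha : R) (phi g : params R H) :
  g = \row_i risk_dir alpha +oo%E phi (delta_mx 0 i) ->
  enorm g ^+ 2 + entry g (3 * H + 1) ^+ 2 <=
  8 * (1 + enorm phi ^+ 2) * risk alpha +oo%E phi.
Proof.
move=> gE; set c := entry g (3 * H + 1)%N; set S := _ + _.
have ST : S = risk_dir alpha +oo%E phi (c *: last_dir H + g).
  rewrite risk_dir_linear [X in _ * X + _](_ : _ = c); last first.
    by rewrite /c /entry gE mxE addn1.
  rewrite risk_dir_coord addrC -expr2 /S sqr_enorm; congr (_ + _).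
  by apply: eq_bigr => i _; rewrite expr2 {2}gE mxE.
have [i1 _] := bounded_cvg_integral (bounded_cvg_risk alpha phi).
have [i2 _] := bounded_cvg_integral
  (bounded_cvg_risk_dir alpha phi (c *: last_dir H + g)).
set K := 4 * (1 + enorm phi ^+ 2).
have i3 := unit_integrableZl K i1.
have i4 : unit_integrable (fun _ : R => 2^-1 * S).
  by apply: bounded_over_integrable; [exact: measurable_cst|exact: bounded_over_cst].
have : S <= \int[lebesgue_measure]_(y in `[0, 1])
    (2^-1 * S + K * (network +oo%E phi y - alpha) ^+ 2).
  rewrite {1}ST; apply: le_unit_Rintegral => //; first exact: unit_integrableD.
  by move=> y y01; exact: dnetwork_bound.
rewrite unit_RintegralD// unit_RintegralZl// unit_Rintegral_cst -/(risk _ _ _).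
rewrite /K; lra.
Qed.

(** * Descent of the Lyapunov function and convergence of the risks *)

Lemma lyapunov_step {R : realType} {H : nat} (alpha gamma : R)
    (phi g : params R H) : 0 <= gamma ->
  g = \row_i risk_dir alpha +oo%E phi (delta_mx 0 i) ->
  lyapunov alpha (phi - gamma *: g) <= lyapunov alpha phi -
    8 * gamma * (1 - gamma * (1 + lyapunov alpha phi)) * risk alpha +oo%E phi.
Proof.
move=> gamma0 gE; have := gradient_bound gE.
have := risk_dir_lyapunov alpha phi.
have e0 : risk_dir alpha +oo%E phi (last_dir H) = entry g (3 * H + 1).
  by rewrite /entry gE mxE addn1.
rewrite risk_dir_linear e0 risk_dir_coord.
rewrite (eq_bigr (fun i => phi 0 i * g 0 i)); last by move=> i _; rewrite gE mxE.
have L0 := risk_ge0 alpha +oo%E phi.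
rewrite /lyapunov !sqr_enorm.
have -> : \sum_i (phi - gamma *: g) 0 i ^+ 2 = \sum_i phi 0 i ^+ 2 -
    2 * gamma * (\sum_i phi 0 i * g 0 i) + gamma ^+ 2 * (\sum_i g 0 i ^+ 2).
  rewrite !mulr_sumr -sumrN -!big_split/=; apply: eq_bigr => i _.
  by rewrite !mxE; ring.
rewrite (_ : phi - gamma *: g = (- gamma) *: g + phi); last first.
  by rewrite scaleNr addrC.
rewrite entryD; move: (entry g _) (entry phi _) (\sum_i _) (\sum_i _) (\sum_i _) L0.
move: (risk _ _ _) => L c p X Y Z L0 hX hY.
have g2 : 0 <= gamma ^+ 2 by exact: sqr_ge0.
(* The gradient bound contains [|phi|^2]; passing to the Lyapunov function costs exactly a
   nonnegative multiple of this term. *)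
have hL : 0 <= gamma ^+ 2 * L * (p - 2 * alpha) ^+ 2.
  by rewrite mulr_ge0 ?sqr_ge0// mulr_ge0.
have := ler_wpM2l g2 hY.
have := congr1 ( *%R gamma) hX.
lra.
Qed.

Lemma lyapunov_ge0 {R : realType} {H : nat} (alpha : R) (phi : params R H) :
  0 <= lyapunov alpha phi.
Proof. by rewrite addr_ge0// sqr_ge0. Qed.

Lemma enorm_le_lyapunov {R : realType} {H : nat} (alpha : R) (phi : params R H) :
  enorm phi <= Num.sqrt (lyapunov alpha phi).
Proof.
rewrite -[enorm phi]ger0_norm ?sqrtr_ge0// -sqrtr_sqr ler_sqrt ?lyapunov_ge0//.
by rewrite lerDl sqr_ge0.
Qed.

Theorem theorem4p4 (R : realType) (H : nat) (hH : (0 < H)%N) (alpha : R)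
    (G : params R H -> params R H) (hG : is_generalized_gradient alpha G)
    (gamma : R) (hgamma : 0 < gamma)
    (Theta : nat -> params R H)
    (hTheta : forall n : nat, Theta n.+1 = Theta n - gamma *: G (Theta n))
    (hstep : gamma <= (4 * lyapunov alpha (Theta 0%N) + 2)^-1) :
  (ereal_sup (range (fun n : nat => (enorm (Theta n))%:E))
     <= (Num.sqrt (lyapunov alpha (Theta 0%N)))%:E < +oo)%E
  /\ limn_esup (fun n : nat => (risk alpha +oo%E (Theta n))%:E) = 0%E.
Proof.
set V := fun n => lyapunov alpha (Theta n).
set L := fun n => risk alpha +oo%E (Theta n).
have V_ge0 n : 0 <= V n by exact: lyapunov_ge0.
have L_ge0 n : 0 <= L n by exact: risk_ge0.
(* The step size is controlled through [V 0] only, so the decrease is first shown under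
   [V n <= V 0], which the induction then propagates. *)
have decr n : V n <= V 0%N -> V n.+1 <= V n - 4 * gamma * L n.
  move=> Vn; rewrite /V hTheta.
  apply: le_trans (lyapunov_step _ (generalized_gradientE _ hG)) _.
    exact: ltW.
  rewrite -/(V n) -/(L n) lerD2l lerN2 ler_wpM2r//.
  have V2 : 0 < 4 * V 0%N + 2 by have := V_ge0 0%N; lra.
  have : gamma * (4 * V 0%N + 2) <= 1 by rewrite -ler_pdivlMr// mul1r.
  have : gamma * V n <= gamma * V 0%N by rewrite ler_pM2l.
  have h0 : 0 <= gamma * V 0%N by rewrite mulr_ge0// ltW.
  (* The hypotheses give [2 gamma (1 + V n) <= 1], so the factor [1 - gamma (1 + V n)] is at least
     one half and 8 becomes 4. *)
  move=> h1 h2; have : 0 <= gamma * (1 - 2 * gamma * (1 + V n)).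
    by rewrite mulr_ge0 ?(ltW hgamma)//; lra.
  by lra.
have V_le0 n : V n <= V 0%N.
  elim: n => [|n IH]; first exact: lexx.
  apply: le_trans (decr n IH) (le_trans _ IH).
  by rewrite gerBl mulr_ge0// mulr_ge0// ltW.
have V_decr n : V n.+1 <= V n - 4 * gamma * L n by exact: decr.
split.
  rewrite ltry andbT; apply: ub_ereal_sup => _ [n _ <-]; rewrite lee_fin.
  apply: le_trans (enorm_le_lyapunov alpha (Theta n)) _.
  by rewrite ler_sqrt ?V_le0 ?V_ge0.
have V_cvg : cvgn V.
  apply: nonincreasing_is_cvgn; last by exists 0 => _ [n _ <-].
  apply/nonincreasing_seqP => n; apply: le_trans (V_decr n) _.
  by rewrite gerBl mulr_ge0// mulr_ge0// ltW.
(* [V] converges, so its consecutive differences tend to 0; after division by [4 gamma] they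
   dominate the risks. *)
have D_cvg : (4 * gamma)^-1 * (V n - V n.+1) @[n --> \oo] --> (0 : R).
  rewrite (_ : 0 = (4 * gamma)^-1 * (limn V - limn V)); last first.
    by rewrite subrr mulr0.
  apply: cvgM; first exact: cvg_cst.
  apply: cvgB; first exact: V_cvg.
  by rewrite (@cvg_shiftS _ V (nbhs (limn V))); exact: V_cvg.
have L_cvg : L n @[n --> \oo] --> (0 : R).
  apply: (squeeze_cvgr _ (cvg_cst (0 : R)) D_cvg); apply: nearW => n.
  rewrite L_ge0/= mulrC ler_pdivlMr ?mulr_gt0// mulrC.
  by have := V_decr n; lra.
have LE_cvg : (L n)%:E @[n --> \oo] --> 0%E.
  by apply: cvg_EFin; [exact: nearW|exact: L_cvg].
rewrite is_cvg_limn_esupE; first exact/cvg_lim.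
by apply/cvg_ex; eexists; exact: LE_cvg.
Qed.
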